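(* Let $q\in\mathbb{R}^n$ and let $M\in\mathbb{R}^{n\times n}$ be a symmetric and positive definite matrix. Then, for any starting point $x^0\in\mathbb{R}^n$, the semi-smooth Newton sequence $\{x^k\}$ generated by $$\big[[M-\mathrm{Id}_n]V(x^k)+\mathrm{Id}_n\big]x^{k+1}=-q,\qquad V(x^k)\in\partial_BP_{\mathcal K}(x^k),\qquad k=0,1,\ldots,$$ is well-defined. Additionally, if $M-\mathrm{Id}_n$ is positive definite and $\|M-\mathrm{Id}_n\|<1$, then the equation $$[M-\mathrm{Id}_n]P_{\mathcal K}(x)+x=-q,\qquad x\in\mathbb{R}^n,$$ has a unique solution $x^*\in\mathbb{R}^n$ and $\{x^k\}$ converges $Q$-linearly to $x^*$ as follows: $$\|x^*-x^{k+1}\|\le\|M-\mathrm{Id}_n\|\,\|x^*-x^k\|,\qquad k=0,1,\ldots.$$ Moreover, $P_{\mathcal K}(x^* )$ is a solution of the linear second order cone complementarity problem: find $z\in\mathbb{R}^n$ such that $z\in\mathcal K$, $Mz+q\in\mathcal K$ and $\langle Mz+q,z\rangle=0$.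
   Context: $\mathbb{R}^n$ carries the canonical inner product $\langle\cdot,\cdot\rangle$ and Euclidean norm $\|\cdot\|$; for a matrix $E\in\mathbb{R}^{n\times n}$, $\|E\|=\max\{\|Ex\|: \|x\|=1\}$; $\mathrm{Id}_n$ is the $n\times n$ identity matrix. $\mathcal K=\{x=(x_1,x_2)\in\mathbb{R}\times\mathbb{R}^{n-1}: \|x_2\|\le x_1\}$ is the second order cone and $P_{\mathcal K}$ is the Euclidean metric projection onto $\mathcal K$. For a locally Lipschitz map $F:\mathbb{R}^n\to\mathbb{R}^m$, with $D_F$ the set of points where $F$ is differentiable and $F'$ its Jacobian, the B-subdifferential is $\partial_BF(x)=\{V\in\mathbb{R}^{m\times n}: \exists\,\{x^k\}\subset D_F,\ x^k\to x,\ F'(x^k)\to V\}$. In the Newton iteration $V(x^k)$ is an arbitrary element of $\partial_BP_{\mathcal K}(x^k)$; ''well-defined'' means that the linear system at each step has a nonsingular matrix, so that $x^{k+1}$ exists and is unique, whatever the choice of $V(x^k)$. *)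

(* Defs.v *)
From HB Require Import structures.
From mathcomp Require Import all_boot all_order all_algebra.
From mathcomp Require Import all_classical all_reals all_analysis.

Set Implicit Arguments.
Unset Strict Implicit.
Unset Printing Implicit Defensive.

Import Order.TTheory GRing.Theory Num.Theory.
Import numFieldNormedType.Exports.

Local Open Scope classical_set_scope.
Local Open Scope ring_scope.

(* The library norm `|x| on 'cV[R]_n is the sup norm, hence the explicit
   Euclidean norm below.  In finite dimension both norms induce the same
   topology and the same Frechet differential, so convergence (-->) and
   differentiability are the library's. *)
Definition dot (R : realType) (n : nat) (x y : 'cV[R]_n) : R :=
  \sum_(i < n) x i 0 * y i 0.

Definition enorm (R : realType) (n : nat) (x : 'cV[R]_n) : R :=
  Num.sqrt (dot x x).

(* The supremum is a maximum: the unit sphere is compact, and nonempty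
   when n > 0. *)
Definition opnorm (R : realType) (n : nat) (E : 'M[R]_n) : R :=
  sup [set enorm (E *m x) | x in [set x : 'cV[R]_n | enorm x = 1]].

Definition posdef (R : realType) (n : nat) (A : 'M[R]_n) : Prop :=
  forall x : 'cV[R]_n, x != 0 -> 0 < dot (A *m x) x.

(* x = (x_1, x_2) in R x R^n: x_1 is [x 0 0], x_2 is the lower block of x. *)
Definition soc (R : realType) (n : nat) : set 'cV[R]_n.+1 :=
  [set x | enorm (dsubmx (x : 'cV[R]_(1 + n))) <= x 0 0].

Definition is_metric_proj (R : realType) (n : nat) (K : set 'cV[R]_n)
    (x p : 'cV[R]_n) : Prop :=
  K p /\ forall y, K y -> enorm (x - p) <= enorm (x - y).

(* For a nonempty closed convex K, such as the second order cone, the nearest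
   point exists and is unique; the default value 0 is then never used. *)
Definition metric_proj (R : realType) (n : nat) (K : set 'cV[R]_n)
    (x : 'cV[R]_n) : 'cV[R]_n :=
  xget 0 [set p | is_metric_proj K x p].

(* The library's [jacobian] is the matrix acting on row vectors; this one
   satisfies 'd F x h = jacobian_col F x *m h. *)
Definition jacobian_col (R : realType) (n m : nat)
    (F : 'cV[R]_n -> 'cV[R]_m) (x : 'cV[R]_n) : 'M[R]_(m, n) :=
  \matrix_(i < m, j < n) ('d F x (delta_mx j 0)) i 0.

Definition Bsubdiff (R : realType) (n m : nat)
    (F : 'cV[R]_n -> 'cV[R]_m) (x : 'cV[R]_n) : set 'M[R]_(m, n) :=
  [set V | exists u : nat -> 'cV[R]_n,
    [/\ forall k, differentiable F (u k),
        u @ \oo --> x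
      & (fun k => jacobian_col F (u k)) @ \oo --> V]].

Definition newton_mx (R : realType) (n : nat) (M V : 'M[R]_n) : 'M[R]_n :=
  (M - 1%:M) *m V + 1%:M.

Definition newton_step (R : realType) (n : nat) (M : 'M[R]_n.+1)
    (q x y : 'cV[R]_n.+1) : Prop :=
  exists2 V, Bsubdiff (metric_proj (@soc R n)) x V & newton_mx M V *m y = - q.

Definition newton_sequence (R : realType) (n : nat) (M : 'M[R]_n.+1)
    (q x0 : 'cV[R]_n.+1) (x : nat -> 'cV[R]_n.+1) : Prop :=
  x 0%N = x0 /\ forall k, newton_step M q (x k) (x k.+1).

(* Whatever choices produced x^0, ..., x^k, an element V of the B-subdifferential
   at x^k is available, and every such V determines a unique x^{k+1} through a
   nonsingular system. *)
Definition newton_well_defined (R : realType) (n : nat) (M : 'M[R]_n.+1)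
    (q x0 : 'cV[R]_n.+1) : Prop :=
  forall (k : nat) (x : nat -> 'cV[R]_n.+1),
    x 0%N = x0 ->
    (forall j, (j < k)%N -> newton_step M q (x j) (x j.+1)) ->
    Bsubdiff (metric_proj (@soc R n)) (x k) !=set0 /\
    forall V, Bsubdiff (metric_proj (@soc R n)) (x k) V ->
      newton_mx M V \in unitmx /\ exists! y, newton_mx M V *m y = - q.

Definition newton_equation (R : realType) (n : nat) (M : 'M[R]_n.+1)
    (q x : 'cV[R]_n.+1) : Prop :=
  (M - 1%:M) *m metric_proj (@soc R n) x + x = - q.

Definition soc_lcp_solution (R : realType) (n : nat) (M : 'M[R]_n.+1)
    (q z : 'cV[R]_n.+1) : Prop :=
  [/\ soc z, soc (M *m z + q) & dot (M *m z + q) z = 0].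

(* Main.v *)
(** The projection [P] onto the self-dual cone is firmly nonexpansive and
    positively homogeneous.  Passing to derivatives and then to limits, every
    [V] in its B-subdifferential at [x] satisfies [|V h|^2 <= <V h, h>] and
    [V x = P x].  If [newton_mx M V] kills [h] then [M V h = V h - h], so
    [<M V h, V h> <= 0], whence [V h = 0] and [h = 0].  For the rate put
    [A = M - 1], [e = x* - x^(k+1)] and
    [w = V (x* - x^k) - (P x* - P x^k)]: the iteration reads
    [e = A (w - V e)], firm nonexpansiveness gives [|w| <= |x* - x^k|], and
    cocoercivity of the symmetric positive definite [A] gives
    [|e|^2 <= |A| <e, w - V e> <= |A| <e, w>]. *)

Require Import Defs.
From mathcomp Require Import all_boot all_order all_algebra.
From mathcomp Require Import all_classical all_reals all_analysis.
From HB Require Import structures.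
From mathcomp Require Import ring lra.
Import Order.TTheory GRing.Theory Num.Theory.
Import numFieldNormedType.Exports.
Local Open Scope classical_set_scope.
Local Open Scope ring_scope.

Set Implicit Arguments.
Unset Strict Implicit.
Unset Printing Implicit Defensive.

(** * Inner product, Euclidean norm and operator norm *)

Lemma dotC (R : realType) (n : nat) (x y : 'cV[R]_n) : dot x y = dot y x.
Proof. by apply: eq_bigr => i _; rewrite mulrC. Qed.

Lemma dotDl (R : realType) (n : nat) (x y z : 'cV[R]_n) :
  dot (x + y) z = dot x z + dot y z.
Proof.
by rewrite /dot -big_split; apply: eq_bigr => i _; rewrite mxE mulrDl.
Qed.

Lemma dotZl (R : realType) (n : nat) (a : R) (x y : 'cV[R]_n) :
  dot (a *: x) y = a * dot x y.
Proof.
by rewrite /dot mulr_sumr; apply: eq_bigr => i _; rewrite mxE mulrA.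
Qed.

Lemma dotNl (R : realType) (n : nat) (x y : 'cV[R]_n) :
  dot (- x) y = - dot x y.
Proof. by rewrite -scaleN1r dotZl mulN1r. Qed.

Lemma dotDr (R : realType) (n : nat) (x y z : 'cV[R]_n) :
  dot x (y + z) = dot x y + dot x z.
Proof. by rewrite dotC dotDl !(dotC x). Qed.

Lemma dotZr (R : realType) (n : nat) (a : R) (x y : 'cV[R]_n) :
  dot x (a *: y) = a * dot x y.
Proof. by rewrite dotC dotZl dotC. Qed.

Lemma dotNr (R : realType) (n : nat) (x y : 'cV[R]_n) :
  dot x (- y) = - dot x y.
Proof. by rewrite dotC dotNl dotC. Qed.

Lemma dot0l (R : realType) (n : nat) (y : 'cV[R]_n) : dot 0 y = 0.
Proof. by rewrite -(scale0r 0) dotZl mul0r. Qed.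

Definition dotlin := (dotDl, dotDr, dotNl, dotNr, dotZl, dotZr).

Lemma dot_ge0 (R : realType) (n : nat) (x : 'cV[R]_n) : 0 <= dot x x.
Proof. by apply: sumr_ge0 => i _; rewrite -expr2 sqr_ge0. Qed.

Lemma dot_eq0 (R : realType) (n : nat) (x : 'cV[R]_n) : dot x x = 0 -> x = 0.
Proof.
move=> /eqP; rewrite psumr_eq0 => [/allP x0|i _]; last first.
  by rewrite -expr2 sqr_ge0.
apply/colP => i; rewrite mxE; have /= := x0 i (mem_index_enum i).
by rewrite -expr2 sqrf_eq0 => /eqP.
Qed.

Lemma dot_coordE (R : realType) (n : nat) (x : 'cV[R]_n) (i : 'I_n) :
  dot (delta_mx i 0) x = x i 0.
Proof.
rewrite /dot (bigD1 i) //= big1 => [|j ji]; last first.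
  by rewrite mxE (negbTE ji) mul0r.
by rewrite mxE !eqxx mul1r addr0.
Qed.

(** The quadratic is evaluated at its minimiser [b / c]; when [c = 0] it is affine in [t], and a
    nonnegative affine function has zero slope. *)
Lemma discriminant_le (R : realType) (a b c : R) :
  (forall t, 0 <= a - 2 * t * b + t ^+ 2 * c) -> 0 <= c -> 0 <= a ->
  b ^+ 2 <= a * c.
Proof.
move=> quad c0 a0; have [cE|cN0] := eqVneq c 0.
  suff -> : b = 0 by rewrite cE mulr0 expr0n.
  (* At this [t] the affine function takes the value [-1]. *)
  apply/eqP/negPn/negP => bN0; have := quad ((a + 1) / (2 * b)).
  have -> : 2 * ((a + 1) / (2 * b)) * b = a + 1 by field.
  by rewrite cE mulr0; lra.
have := quad (b / c).
have -> : a - 2 * (b / c) * b + (b / c) ^+ 2 * c = (a * c - b ^+ 2) / c.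
  by field.
by rewrite pmulr_lge0 ?subr_ge0 // invr_gt0 lt_neqAle eq_sym cN0.
Qed.

(** The form at [x - t *: y] is a nonnegative quadratic in [t]. The case [B = 1] is the usual
    inequality; [B = M - 1] later gives cocoercivity. *)
Lemma cauchy_schwarz_form (R : realType) (n : nat) (B : 'M[R]_n)
    (x y : 'cV[R]_n) :
  (forall u v, dot (B *m u) v = dot (B *m v) u) ->
  (forall u, 0 <= dot (B *m u) u) ->
  dot (B *m x) y ^+ 2 <= dot (B *m x) x * dot (B *m y) y.
Proof.
move=> Bsym Bpos.
have := Bpos x; have := Bpos y.
apply: discriminant_le => t; have := Bpos (x - t *: y).
by rewrite mulmxBr -scalemxAr !dotlin (Bsym y x); lra.
Qed.

Lemma cauchy_schwarz_dot (R : realType) (n : nat) (x y : 'cV[R]_n) :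
  dot x y ^+ 2 <= dot x x * dot y y.
Proof.
have := @cauchy_schwarz_form R n 1%:M x y; rewrite !mul1mx; apply => u.
  by move=> v; rewrite !mul1mx dotC.
by rewrite mul1mx dot_ge0.
Qed.

Lemma sqr_enorm (R : realType) (n : nat) (x : 'cV[R]_n) :
  enorm x ^+ 2 = dot x x.
Proof. by rewrite sqr_sqrtr // dot_ge0. Qed.

Lemma enorm_ge0 (R : realType) (n : nat) (x : 'cV[R]_n) : 0 <= enorm x.
Proof. exact: sqrtr_ge0. Qed.

Lemma enorm_le (R : realType) (n m : nat) (x : 'cV[R]_n) (y : 'cV[R]_m) :
  (enorm x <= enorm y) = (dot x x <= dot y y).
Proof. by rewrite ler_sqrt // dot_ge0. Qed.

Lemma enorm_eq0 (R : realType) (n : nat) (x : 'cV[R]_n) :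
  enorm x = 0 -> x = 0.
Proof. by move=> x0; apply: dot_eq0; rewrite -sqr_enorm x0 expr0n. Qed.

Lemma enorm0 (R : realType) (n : nat) : enorm (0 : 'cV[R]_n) = 0.
Proof. by rewrite /enorm dot0l sqrtr0. Qed.

Lemma dot_le_enorm (R : realType) (n : nat) (x y : 'cV[R]_n) :
  dot x y <= enorm x * enorm y.
Proof.
rewrite (le_trans (ler_norm _)) // -(@ler_pXn2r _ 2) ?nnegrE //.
  by rewrite real_normK ?num_real // exprMn !sqr_enorm cauchy_schwarz_dot.
by rewrite mulr_ge0 ?enorm_ge0.
Qed.

Lemma enormZ (R : realType) (n : nat) (a : R) (x : 'cV[R]_n) :
  enorm (a *: x) = `|a| * enorm x.
Proof. by rewrite /enorm !dotlin mulrA -expr2 sqrtrM ?sqr_ge0 // sqrtr_sqr. Qed.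

Lemma enormN (R : realType) (n : nat) (x : 'cV[R]_n) : enorm (- x) = enorm x.
Proof. by rewrite -scaleN1r enormZ normrN normr1 mul1r. Qed.

(** Together with the reverse estimate [enorm_le_normr], this carries limits and contraction bounds
    between the Euclidean and the sup norm. *)
Lemma normr_le_enorm (R : realType) (n : nat) (x : 'cV[R]_n) :
  `|x| <= enorm x.
Proof.
rewrite [leLHS]/Num.Def.normr /= mx_normrE; apply: bigmax_le => [|[i j] _ /=].
  exact: enorm_ge0.
rewrite ord1 -(@ler_pXn2r _ 2) ?nnegrE ?enorm_ge0 // real_normK ?num_real //.
rewrite sqr_enorm /dot (bigD1 i) //= -expr2 lerDl.
by apply: sumr_ge0 => k _; rewrite -expr2 sqr_ge0.
Qed.

Lemma normr_coord_le (R : realType) (n : nat) (x : 'cV[R]_n) (i : 'I_n) :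
  `|x i 0| <= `|x|.
Proof.
rewrite [leRHS]/Num.Def.normr /= mx_normrE.
by apply/bigmax_geP; right => /=; exists (i, 0).
Qed.

Lemma enorm_le_normr (R : realType) (n : nat) (x : 'cV[R]_n) :
  enorm x <= Num.sqrt n%:R * `|x|.
Proof.
rewrite -[`|x|]normr_id -sqrtr_sqr -sqrtrM // ler_sqrt ?mulr_ge0 ?sqr_ge0 //.
rewrite (le_trans (y := \sum_(i < n) `|x| ^+ 2)) //; last first.
  by rewrite sumr_const card_ord mulr_natl.
apply: ler_sum => i _; rewrite -expr2 -real_normK ?num_real //.
by rewrite ler_pXn2r ?nnegrE // normr_coord_le.
Qed.

(** Cauchy-Schwarz on each row bounds the set by the Frobenius norm of [E], so that [sup] does
    dominate every value on the unit sphere. *)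
Lemma opnorm_has_ubound (R : realType) (n : nat) (E : 'M[R]_n) :
  has_ubound [set enorm (E *m x) | x in [set x : 'cV[R]_n | enorm x = 1]].
Proof.
exists (Num.sqrt (\sum_(i < n) dot (row i E)^T (row i E)^T)) => _ [x x1 <-].
rewrite ler_sqrt; last by apply: sumr_ge0 => i _; exact: dot_ge0.
apply: ler_sum => i _.
have -> : (E *m x) i 0 = dot (row i E)^T x.
  by rewrite mxE; apply: eq_bigr => j _; rewrite !mxE.
rewrite -expr2 (le_trans (cauchy_schwarz_dot _ _)) // -(sqr_enorm x) x1.
by rewrite expr1n mulr1.
Qed.

Lemma enorm_mulmx_le (R : realType) (n : nat) (E : 'M[R]_n) (x : 'cV[R]_n) :
  enorm (E *m x) <= opnorm E * enorm x.
Proof.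
have [x0|xN0] := eqVneq (enorm x) 0.
  by rewrite x0 mulr0 (enorm_eq0 x0) mulmx0 enorm0.
have xpos : 0 < enorm x by rewrite lt_neqAle eq_sym xN0 enorm_ge0.
rewrite -ler_pdivrMr //.
have -> : enorm (E *m x) / enorm x = enorm (E *m ((enorm x)^-1 *: x)).
  by rewrite -scalemxAr enormZ ger0_norm ?invr_ge0 ?enorm_ge0 // mulrC.
apply: ub_le_sup; first exact: opnorm_has_ubound.
exists ((enorm x)^-1 *: x) => //=.
by rewrite enormZ ger0_norm ?invr_ge0 ?enorm_ge0 // mulVf.
Qed.

(** * The second order cone and its metric projection *)

Definition soc_tail (R : realType) (n : nat) (x : 'cV[R]_n.+1) : 'cV[R]_n :=
  dsubmx (x : 'cV[R]_(1 + n)).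

Definition soc_axis (R : realType) (n : nat) : 'cV[R]_n.+1 := delta_mx 0 0.

Lemma soc_tailE (R : realType) (n : nat) (x : 'cV[R]_n.+1) (i : 'I_n) :
  soc_tail x i 0 = x (lift 0 i) 0.
Proof. by rewrite mxE; congr (x _ _); apply: val_inj. Qed.

Lemma soc_tailD (R : realType) (n : nat) (x y : 'cV[R]_n.+1) :
  soc_tail (x + y) = soc_tail x + soc_tail y.
Proof. by apply/colP => i; rewrite !mxE. Qed.

Lemma soc_tailZ (R : realType) (n : nat) (a : R) (x : 'cV[R]_n.+1) :
  soc_tail (a *: x) = a *: soc_tail x.
Proof. by apply/colP => i; rewrite !mxE. Qed.

Lemma soc_tailN (R : realType) (n : nat) (x : 'cV[R]_n.+1) :
  soc_tail (- x) = - soc_tail x.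
Proof. by apply/colP => i; rewrite !mxE. Qed.

Lemma soc_tail_axis (R : realType) (n : nat) : soc_tail (soc_axis R n) = 0.
Proof. by apply/colP => i; rewrite soc_tailE !mxE eqxx andbT. Qed.

Lemma soc_axis0 (R : realType) (n : nat) : soc_axis R n 0 0 = 1.
Proof. by rewrite mxE !eqxx. Qed.

Lemma dot_socE (R : realType) (n : nat) (x y : 'cV[R]_n.+1) :
  dot x y = x 0 0 * y 0 0 + dot (soc_tail x) (soc_tail y).
Proof.
rewrite /dot big_ord_recl; congr (_ + _); apply: eq_bigr => i _.
by rewrite !soc_tailE.
Qed.

Lemma socE (R : realType) (n : nat) (x : 'cV[R]_n.+1) :
  soc x = (enorm (soc_tail x) <= x 0 0) :> Prop.
Proof. by []. Qed.

(** One half of self-duality: [<x_2, y_2> >= - |x_2| |y_2| >= - x_1 y_1]. *)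
Lemma soc_dot_ge0 (R : realType) (n : nat) (x y : 'cV[R]_n.+1) :
  soc x -> soc y -> 0 <= dot x y.
Proof.
rewrite !socE => Kx Ky; rewrite dot_socE.
have := dot_le_enorm (- soc_tail x) (soc_tail y); rewrite dotNl enormN.
by have := ler_pM (enorm_ge0 _) (enorm_ge0 _) Kx Ky; lra.
Qed.

(* Moreau's characterization of [p] as the projection of [x]; as the cone is
   self-dual, [p - x] is required to lie in the cone itself. *)
Definition moreau_pair (R : realType) (n : nat) (x p : 'cV[R]_n.+1) : Prop :=
  [/\ soc p, soc (p - x) & dot (p - x) p = 0].

(** Orthogonality gives [|x - y|^2 = |x - p|^2 + 2 <p - x, y> + |p - y|^2], whose middle term is
    nonnegative on the cone. The surplus [|p - y|^2] yields both minimality of [p] and its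
    uniqueness. *)
Lemma moreau_metric_proj (R : realType) (n : nat) (x p : 'cV[R]_n.+1) :
  moreau_pair x p -> metric_proj (@soc R n) x = p.
Proof.
move=> [Kp Kpx px0].
have pyth y : dot (x - y) (x - y)
    = dot (x - p) (x - p) + 2 * dot (p - x) y + dot (p - y) (p - y).
  have : dot (p - x) p = 0 by [].
  by rewrite !dotlin (dotC y x) (dotC y p) (dotC p x); lra.
have pmin y : soc y -> dot (x - p) (x - p) + dot (p - y) (p - y)
    <= dot (x - y) (x - y).
  by move=> Ky; rewrite (pyth y); have := soc_dot_ge0 Kpx Ky; lra.
have projp : is_metric_proj (@soc R n) x p.
  split=> // y Ky; rewrite enorm_le.
  by have := pmin y Ky; have := dot_ge0 (p - y); lra.
rewrite /metric_proj; apply: xget_unique => //= y [Ky /(_ p Kp)].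
rewrite enorm_le => yp; apply/esym/subr0_eq/dot_eq0.
by have := pmin y Ky; have := dot_ge0 (p - y); lra.
Qed.

(** The positive spectral part of [x], namely [(x_1 + |x_2|) / 2] times [(1, x_2 / |x_2|)]; it is
    the projection when [x] lies in neither the cone nor its negative. The vector [x - x_1 e], with
    [e] the axis, is [(0, x_2)]. *)
Definition soc_midproj (R : realType) (n : nat) (x : 'cV[R]_n.+1) :
    'cV[R]_n.+1 :=
  ((x 0 0 + enorm (soc_tail x)) / 2) *: soc_axis R n +
  ((x 0 0 + enorm (soc_tail x)) / 2 / enorm (soc_tail x)) *:
    (x - x 0 0 *: soc_axis R n).

(** With [u = x_2 / r], the vectors [p = c (1, u)] and [p - x = ((r - x_1) / 2) (1, - u)] lie on two
    orthogonal boundary rays of the cone. *)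
Lemma moreau_midproj (R : realType) (n : nat) (x : 'cV[R]_n.+1) :
  `|x 0 0| < enorm (soc_tail x) -> moreau_pair x (soc_midproj x).
Proof.
rewrite ltr_norml => /andP[]; set r := enorm _ => rx xr.
have r0 : 0 < r by lra.
set p := soc_midproj x; set c := (x 0 0 + r) / 2.
have p0 : p 0 0 = c.
  rewrite /p /soc_midproj -/r -/c.
  by rewrite !mxE !eqxx /= !mulr1 subrr mulr0 addr0.
have pt : soc_tail p = (c / r) *: soc_tail x.
  rewrite /p /soc_midproj -/r -/c soc_tailD !soc_tailZ soc_tailD soc_tailN.
  by rewrite soc_tailZ soc_tail_axis !scaler0 oppr0 addr0 add0r.
have rN0 : r != 0 by rewrite gt_eqF.
have px0 : (p - x) 0 0 = (r - x 0 0) / 2 by rewrite mxE p0 mxE /c; field.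
have pxt : soc_tail (p - x) = (c / r - 1) *: soc_tail x.
  by rewrite soc_tailD soc_tailN pt scalerBl scale1r.
have cr : c / r - 1 = - ((r - x 0 0) / 2 / r) by rewrite /c; field.
split.
- rewrite socE p0 pt enormZ -/r ger0_norm ?divfK //.
  by rewrite divr_ge0 ?(ltW r0) // /c; lra.
- rewrite socE px0 pxt enormZ -/r cr normrN ger0_norm ?divfK //.
  by rewrite divr_ge0 ?(ltW r0) //; lra.
- rewrite dot_socE px0 pxt p0 pt !dotlin -sqr_enorm -/r cr /c.
  by field.
Qed.

Lemma moreau_soc (R : realType) (n : nat) (x : 'cV[R]_n.+1) :
  soc x -> moreau_pair x x.
Proof.
move=> Kx; split=> //; rewrite subrr ?dot0l // socE.
by rewrite -(scale0r 0) soc_tailZ scale0r enorm0 mxE mul0r.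
Qed.

Lemma moreau_socN (R : realType) (n : nat) (x : 'cV[R]_n.+1) :
  soc (- x) -> moreau_pair x 0.
Proof.
move=> Kx; split; rewrite ?sub0r 1?dotC ?dot0l // socE.
by rewrite -(scale0r 0) soc_tailZ scale0r enorm0 mxE mul0r.
Qed.

Lemma soc_cases (R : realType) (n : nat) (x : 'cV[R]_n.+1) :
  [\/ soc x, soc (- x) | `|x 0 0| < enorm (soc_tail x)].
Proof.
rewrite !socE soc_tailN enormN mxE.
have [h|h1] := leP (enorm (soc_tail x)) (x 0 0); first exact: Or31.
have [h|h2] := leP (enorm (soc_tail x)) (- x 0 0); first exact: Or32.
by apply: Or33; rewrite ltr_norml h1 andbT; lra.
Qed.

(** Each of the three regions has an explicit Moreau pair. Later estimates can thus use the three
    Moreau conditions in place of minimality. *)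
Lemma metric_proj_moreau (R : realType) (n : nat) (x : 'cV[R]_n.+1) :
  moreau_pair x (metric_proj (@soc R n) x).
Proof.
have [/moreau_soc|/moreau_socN|/moreau_midproj] := soc_cases x => xp;
  by rewrite (moreau_metric_proj xp).
Qed.

(** By the two orthogonality relations, the right side minus the left side is
    [<P x - x, P y> + <P y - y, P x>], a sum of products of cone elements. *)
Lemma metric_proj_firm (R : realType) (n : nat) (x y : 'cV[R]_n.+1) :
  dot (metric_proj (@soc R n) x - metric_proj (@soc R n) y)
      (metric_proj (@soc R n) x - metric_proj (@soc R n) y)
  <= dot (metric_proj (@soc R n) x - metric_proj (@soc R n) y) (x - y).
Proof.
set P := metric_proj _.
have [Kx Kxd x0] := metric_proj_moreau x.
have [Ky Kyd y0] := metric_proj_moreau y.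
rewrite -/(P x) -/(P y) in Kx Kxd x0 Ky Kyd y0.
have := soc_dot_ge0 Kxd Ky; have := soc_dot_ge0 Kyd Kx.
move: x0 y0; rewrite !dotlin.
by rewrite !(dotC (P y)) !(dotC (P x) x) !(dotC (P x) y); lra.
Qed.

Lemma metric_proj_nonexpansive (R : realType) (n : nat) (x y : 'cV[R]_n.+1) :
  enorm (metric_proj (@soc R n) x - metric_proj (@soc R n) y) <= enorm (x - y).
Proof.
have := metric_proj_firm x y; set d := _ - _ => firm.
have [d0|dN0] := eqVneq (enorm d) 0; first by rewrite d0 enorm_ge0.
have dpos : 0 < enorm d by rewrite lt_neqAle eq_sym dN0 enorm_ge0.
rewrite -(ler_pM2l dpos) -expr2 sqr_enorm.
exact: le_trans firm (dot_le_enorm _ _).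
Qed.

Lemma metric_projZ (R : realType) (n : nat) (a : R) (x : 'cV[R]_n.+1) :
  0 <= a -> metric_proj (@soc R n) (a *: x) = a *: metric_proj (@soc R n) x.
Proof.
move=> a0; apply: moreau_metric_proj.
have socZ (y : 'cV[R]_n.+1) : soc y -> soc (a *: y).
  by rewrite !socE soc_tailZ enormZ ger0_norm // mxE => /(ler_wpM2l a0).
have [Kp Kpx px0] := metric_proj_moreau x.
split; rewrite -?scalerBr; [exact: socZ|exact: socZ|].
by rewrite dotZl dotZr px0 !mulr0.
Qed.

(** * Limits, differentials and Jacobians *)

Lemma cvg_coord (R : realType) (T : Type) (F : set_system T) (FF : Filter F)
    (m n : nat) (A : T -> 'M[R]_(m, n)) (B : 'M[R]_(m, n)) i j :
  A t @[t --> F] --> B -> A t i j @[t --> F] --> B i j.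
Proof.
move=> AB.
exact: (cvg_comp A (fun M : 'M[R]_(m, n) => M i j) AB
  (@coord_continuous _ _ _ _ _ _)).
Qed.

Lemma cvg_sum_ord (R : realType) (T : Type) (F : set_system T) (FF : Filter F)
    (n : nat) (f : 'I_n -> T -> R) (a : 'I_n -> R) :
  (forall i, f i t @[t --> F] --> a i) ->
  \sum_(i < n) f i t @[t --> F] --> \sum_(i < n) a i.
Proof. by move=> fa; apply: cvg_big => [|i _]; [exact: add_continuous|]. Qed.

Lemma cvg_dot (R : realType) (T : Type) (F : set_system T) (FF : Filter F)
    (n : nat) (u v : T -> 'cV[R]_n) (a b : 'cV[R]_n) :
  (forall i, u t i 0 @[t --> F] --> a i 0) ->
  (forall i, v t i 0 @[t --> F] --> b i 0) ->
  dot (u t) (v t) @[t --> F] --> dot a b.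
Proof. by move=> ua vb; apply: cvg_sum_ord => i; exact: cvgM. Qed.

Lemma cvg_mulmx_coord (R : realType) (T : Type) (F : set_system T)
    (FF : Filter F) (m n : nat) (A : T -> 'M[R]_(m, n)) (u : T -> 'cV[R]_n)
    (B : 'M[R]_(m, n)) (a : 'cV[R]_n) i :
  A t @[t --> F] --> B -> u t @[t --> F] --> a ->
  (A t *m u t) i 0 @[t --> F] --> (B *m a) i 0.
Proof.
move=> AB ua; rewrite mxE.
under eq_fun do rewrite mxE.
by apply: cvg_sum_ord => j; apply: cvgM; exact: cvg_coord.
Qed.

(** The bridge from Euclidean distances to the library's topology: one direction is the comparison
    of norms, the other the continuity of [dot] and of the square root. *)
Lemma cvg_enorm_dist (R : realType) (T : Type) (F : set_system T)
    (FF : Filter F) (n : nat) (u : T -> 'cV[R]_n) (a : 'cV[R]_n) :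
  enorm (a - u t) @[t --> F] --> 0 <-> u t @[t --> F] --> a.
Proof.
split=> [ua|ua]; last first.
  have dot0 : dot (a - u t) (a - u t) @[t --> F] --> dot (a - a) (a - a).
    have cst_sub : a - u t @[t --> F] --> a - a.
      by apply: cvgB => //; exact: cvg_cst.
    by apply: cvg_dot => i; exact: cvg_coord.
  rewrite subrr dot0l in dot0.
  rewrite -(sqrtr0 R); exact: (cvg_comp _ Num.sqrt dot0 (@sqrt_continuous _ _)).
apply/cvgrPdist_lt => e e0.
have /cvgrPdist_lt/(_ e e0) := ua.
apply: filterS => t; rewrite sub0r normrN ger0_norm ?enorm_ge0 //.
exact/le_lt_trans/normr_le_enorm.
Qed.

(** The first-order expansion of [f] at [x] is also one of [g], and uniqueness of the differential
    identifies its linear part with ['d g x]. *)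
Lemma near_eq_differentiable (R : realType) (V W : normedModType R)
    (f g : V -> W) (x : V) :
  (\forall y \near x, f y = g y) -> differentiable f x -> differentiable g x.
Proof.
move=> fg /diff_locallyP[dfc dfE].
have gE : g \o shift x = cst (g x) + 'd f x +o_ 0 id.
  apply/eqaddoP => e e0; have /eqaddoP/(_ e e0) := dfE.
  move: (fg); rewrite (near_shift 0 x) subr0; apply: filterS2 => y /=.
  by rewrite !fctE /= (nbhs_singleton fg) => ->.
by apply/diff_locallyP; rewrite (diff_unique dfc gE).
Qed.

Lemma jacobian_colE (R : realType) (n m : nat)
    (f : 'cV[R]_n -> 'cV[R]_m) (x : 'cV[R]_n) i j :
  jacobian_col f x i j = ('d f x (delta_mx j 0)) i 0.
Proof. exact: mxE. Qed.

Lemma near_eq_jacobian_col (R : realType) (n m : nat)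
    (f g : 'cV[R]_n -> 'cV[R]_m) (x : 'cV[R]_n) :
  (\forall y \near x, f y = g y) -> differentiable f x ->
  jacobian_col g x = jacobian_col f x.
Proof.
move=> fg df; have dg := near_eq_differentiable fg df.
have dE : 'd g x = 'd f x :> ('cV[R]_n -> 'cV[R]_m).
  (* Both differentials are directional derivatives, which depend only on values near [x]. *)
  apply/funext => h; apply: etrans (esym (deriveE h dg)) _.
  exact: etrans (esym (near_eq_derive h fg)) (deriveE h df).
exact: (congr1 (fun D : 'cV[R]_n -> 'cV[R]_m =>
  \matrix_(i < m, j < n) (D (delta_mx j 0)) i 0) dE).
Qed.

Lemma jacobian_colM (R : realType) (n m : nat)
    (f : 'cV[R]_n -> 'cV[R]_m) (x h : 'cV[R]_n) :
  jacobian_col f x *m h = 'd f x h.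
Proof.
have {2}-> : h = \sum_(j < n) h j 0 *: delta_mx j 0.
  by rewrite {1}(matrix_sum_delta h); apply: eq_bigr => j _; rewrite big_ord1.
rewrite linear_sum; apply/colP => i; rewrite summxE mxE.
by apply: eq_bigr => j _; rewrite jacobian_colE linearZ [RHS]mxE mulrC.
Qed.

Lemma jacobian_col_id (R : realType) (n : nat) (x : 'cV[R]_n) :
  jacobian_col id x = 1%:M.
Proof.
by apply/matrixP => i j; rewrite jacobian_colE diff_val !mxE eqxx andbT.
Qed.

Lemma jacobian_col_cst (R : realType) (n m : nat) (a : 'cV[R]_m)
    (x : 'cV[R]_n) : jacobian_col (cst a) x = 0.
Proof. by apply/matrixP => i j; rewrite jacobian_colE diff_val !mxE. Qed.

Lemma cvg_diff_quotient (R : realType) (V W : normedModType R)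
    (f : V -> W) (x h : V) :
  differentiable f x ->
  t^-1 *: (f (t *: h + x) - f x) @[t --> 0^'] --> 'd f x h.
Proof. by move=> df; rewrite -deriveE //; exact: diff_derivable. Qed.

(** * Jacobians of the projection and their limits *)

(** Firm nonexpansiveness between [x + t h] and [x], divided by [t^2], passes to the limit in the
    difference quotients. *)
Lemma jacobian_proj_firm (R : realType) (n : nat) (x h : 'cV[R]_n.+1) :
  let P := metric_proj (@soc R n) in
  differentiable P x ->
  dot (jacobian_col P x *m h) (jacobian_col P x *m h)
  <= dot (jacobian_col P x *m h) h.
Proof.
move=> P dP; rewrite jacobian_colM; have quot := cvg_diff_quotient (h := h) dP.
pose q t := t^-1 *: (P (t *: h + x) - P x).
apply: (@ler_cvg_to _ 0^' _ _ (fun t => dot (q t) (q t))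
  (fun t => dot (q t) h)).
- by apply: cvg_dot => i; exact: cvg_coord.
- by apply: cvg_dot => i; [exact: cvg_coord|exact: cvg_cst].
near=> t; have tN0 : t != 0 by near: t; exact: nbhs_dnbhs_neq.
rewrite /q !dotZl !dotZr.
have := metric_proj_firm (t *: h + x) x.
rewrite -/P addrK dotZr; move: (dot _ h) => b; move: (dot _ _) => a ab.
(* Both sides get the factor [t^-2], which is nonnegative whatever the sign of [t]. *)
have -> : t^-1 * b = t^-1 * (t^-1 * (t * b)) by rewrite mulKf.
by rewrite mulrA [leRHS]mulrA; apply: ler_wpM2l ab; rewrite -expr2 sqr_ge0.
Unshelve. all: by end_near. Qed.

(** Euler's identity for a positively homogeneous map of degree one: in the direction [x] the
    difference quotient is constantly [P x] for small [t]. *)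
Lemma jacobian_proj_self (R : realType) (n : nat) (x : 'cV[R]_n.+1) :
  let P := metric_proj (@soc R n) in
  differentiable P x -> jacobian_col P x *m x = P x.
Proof.
move=> P dP; rewrite jacobian_colM -deriveE //.
apply: lim_near_cst => //; near=> t => /=.
have tN0 : t != 0 by near: t; exact: nbhs_dnbhs_neq.
(* Homogeneity is applied to [(t + 1) x], so [t] must stay above [-1]. *)
have t1 : 0 <= t + 1.
  rewrite -lerBlDr sub0r; apply: ltW; near: t.
  apply: nbhs_dnbhs; apply: lt_nbhsr; lra.
rewrite -{2}(scale1r x) -scalerDl /P metric_projZ // scalerDl scale1r addrK.
by rewrite scalerA mulVf // scale1r.
Unshelve. all: by end_near. Qed.

Lemma Bsubdiff_proj_firm (R : realType) (n : nat) (x h : 'cV[R]_n.+1)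
    (V : 'M[R]_n.+1) :
  Bsubdiff (metric_proj (@soc R n)) x V ->
  dot (V *m h) (V *m h) <= dot (V *m h) h.
Proof.
move=> [u [du _ JV]].
pose J k := jacobian_col (metric_proj (@soc R n)) (u k) *m h.
have coord i : J k i 0 @[k --> \oo] --> (V *m h) i 0.
  by apply: cvg_mulmx_coord => //; exact: cvg_cst.
apply: (@ler_cvg_to _ \oo _ _ (fun k => dot (J k) (J k))
  (fun k => dot (J k) h)).
- by apply: cvg_dot; exact: coord.
- by apply: cvg_dot; [exact: coord|move=> i; exact: cvg_cst].
- by apply: nearW => k; exact: jacobian_proj_firm.
Qed.

(** Along the defining sequence, [P (u k)] tends to [P x] by nonexpansiveness, while the equal
    vector [J (u k) u k] tends to [V x]. *)
Lemma Bsubdiff_proj_self (R : realType) (n : nat) (x : 'cV[R]_n.+1)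
    (V : 'M[R]_n.+1) :
  Bsubdiff (metric_proj (@soc R n)) x V -> V *m x = metric_proj (@soc R n) x.
Proof.
move=> [u [du ux JV]]; set P := metric_proj _.
have Pux : P (u k) @[k --> \oo] --> P x.
  apply/cvg_enorm_dist; move/cvg_enorm_dist : ux.
  apply: squeeze_cvgr (cvg_cst 0); apply: nearW => k.
  by rewrite enorm_ge0 metric_proj_nonexpansive.
apply/esym/colP => i; apply: (@cvg_unique _ _ (P (u k) i 0 @[k --> \oo])) => //.
  exact: cvg_coord.
have -> : (fun k => P (u k) i 0) = fun k => (jacobian_col P (u k) *m u k) i 0.
  by apply/funext => k; rewrite jacobian_proj_self.
exact: cvg_mulmx_coord.
Qed.

(** * Nonemptiness of the B-subdifferential *)

Lemma cvg_add_harmonic (R : realType) (n : nat) (x v : 'cV[R]_n) :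
  x + k.+1%:R^-1 *: v @[k --> \oo] --> x.
Proof.
rewrite -[X in _ --> X]addr0 -(scale0r v).
apply: cvgD; first exact: cvg_cst.
by apply: cvgZr_tmp; exact: cvg_harmonic.
Qed.

Lemma continuous_enorm_tail (R : realType) (n : nat) :
  continuous (fun y : 'cV[R]_n.+1 => enorm (soc_tail y)).
Proof.
move=> x.
have coord i : soc_tail y i 0 @[y --> x] --> soc_tail x i 0.
  under eq_fun do rewrite soc_tailE.
  by rewrite soc_tailE; exact: coord_continuous.
have dot_cvg := cvg_dot (nbhs_filter x) coord coord.
exact: (cvg_comp _ Num.sqrt dot_cvg (@sqrt_continuous _ _)).
Qed.

Lemma near_soc (R : realType) (n : nat) (x : 'cV[R]_n.+1) :
  enorm (soc_tail x) < x 0 0 -> \forall y \near x, soc y.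
Proof.
move=> xK.
have gap : (y : 'cV[R]_n.+1) 0 0 - enorm (soc_tail y) @[y --> x]
    --> x 0 0 - enorm (soc_tail x).
  exact: (cvgB (@coord_continuous R _ _ 0 0 x) (@continuous_enorm_tail R n x)).
have := @cvgr_gt _ _ _ (nbhs_filter x) _ _ gap 0; rewrite subr_gt0 => /(_ xK).
by apply: filterS => y; rewrite subr_gt0 => /ltW.
Qed.

Lemma near_mid (R : realType) (n : nat) (x : 'cV[R]_n.+1) :
  `|x 0 0| < enorm (soc_tail x) ->
  \forall y \near x, `|(y : 'cV[R]_n.+1) 0 0| < enorm (soc_tail y).
Proof.
move=> xK.
have gap : enorm (soc_tail y) - `|(y : 'cV[R]_n.+1) 0 0| @[y --> x]
    --> enorm (soc_tail x) - `|x 0 0|.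
  exact: (cvgB (@continuous_enorm_tail R n x)
    (cvg_norm (@coord_continuous R _ _ 0 0 x))).
have := @cvgr_gt _ _ _ (nbhs_filter x) _ _ gap 0; rewrite subr_gt0 => /(_ xK).
by apply: filterS => y; rewrite subr_gt0.
Qed.

Lemma differentiable_colP (R : realType) (V : normedModType R) (m : nat)
    (F : V -> 'cV[R]_m) (x : V) :
  (forall i, differentiable (fun y => F y i 0) x) -> differentiable F x.
Proof.
move=> dF.
have -> : F = \sum_(i < m) (fun y => F y i 0 *: delta_mx i 0).
  apply/funext => y; rewrite fct_sumE {1}(matrix_sum_delta (F y)).
  by apply: eq_bigr => i _; rewrite big_ord1.
by apply: differentiable_sum => i; exact: differentiableZl.
Qed.

Lemma differentiable_enorm_tail (R : realType) (n : nat) (x : 'cV[R]_n.+1) :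
  0 < enorm (soc_tail x) ->
  differentiable (fun y : 'cV[R]_n.+1 => enorm (soc_tail y)) x.
Proof.
move=> x0; set d := fun y : 'cV[R]_n.+1 => dot (soc_tail y) (soc_tail y).
have dd : differentiable d x.
  pose f (i : 'I_n) (y : 'cV[R]_n.+1) : R := y (lift 0 i) 0 * y (lift 0 i) 0.
  have -> : d = \sum_(i < n) f i.
    apply/funext => y; rewrite fct_sumE; apply: eq_bigr => i _.
    by rewrite soc_tailE.
  apply: (@differentiable_sum R 'cV[R]_n.+1 R n f) => i.
  by apply: differentiableM; exact: differentiable_coord.
apply: (differentiable_comp dd); apply/derivable1_diffP.
have dx0 : 0 < d x by rewrite /d -sqr_enorm exprn_gt0.
by have [] := is_derive1_sqrt dx0.
Qed.

Lemma differentiable_midproj (R : realType) (n : nat) (x : 'cV[R]_n.+1) :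
  0 < enorm (soc_tail x) -> differentiable (@soc_midproj R n) x.
Proof.
move=> x0; apply: differentiable_colP => i.
pose r (y : 'cV[R]_n.+1) : R := enorm (soc_tail y).
pose c j (y : 'cV[R]_n.+1) : R := y j 0.
pose e : R := soc_axis R n i 0.
(* The coordinate is rewritten through scalar functions so that the rules for sums, products and
   inverses apply. *)
have -> : (fun y => soc_midproj y i 0) = (fun y => (c 0 + r) y * (e / 2)) +
    (fun y => (c 0 + r) y * 2^-1) * (fun y => (r y)^-1) *
    (c i - (fun y => c 0 y * e)).
  by apply/funext => y; rewrite !fctE /r /c /e !mxE; ring.
have dr : differentiable r x by exact: differentiable_enorm_tail.
have dc j : differentiable (c j) x by exact: differentiable_coord.
have dcr : differentiable (c 0 + r) x by exact: differentiableD.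
have dZ (f : 'cV[R]_n.+1 -> R) a : differentiable f x ->
    differentiable (fun y => f y * a) x by move=> df; exact: differentiableZl.
apply: differentiableD; first exact: dZ.
apply: differentiableM; last by apply: differentiableB => //; exact: dZ.
apply: differentiableM; first exact: dZ.
by apply: differentiableV => //; rewrite gt_eqF.
Qed.

(** A point of the cone is approached from the interior, where [P] is the identity, and a point of
    the negative cone from its interior, where [P] vanishes. Elsewhere [P] is differentiable at the
    point itself. *)
Lemma Bsubdiff_proj_nonempty (R : realType) (n : nat) (x : 'cV[R]_n.+1) :
  Bsubdiff (metric_proj (@soc R n)) x !=set0.
Proof.
set P := metric_proj _.
pose u s (k : nat) := x + k.+1%:R^-1 *: (s *: soc_axis R n).
(* The sign [s] selects the direction of approach along the axis; near each [u s k] the map [P]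
   agrees with a map [f] of constant Jacobian [V]. *)
have interior (f : 'cV[R]_n.+1 -> 'cV[R]_n.+1) (s : R) V :
    (forall y, differentiable f y) -> (forall y, jacobian_col f y = V) ->
    (forall k, \forall y \near u s k, f y = P y) ->
    Bsubdiff P x V.
  move=> df Jf fP; exists (u s); split.
  - by move=> k; exact: near_eq_differentiable (fP k) (df _).
  - exact: cvg_add_harmonic.
  - have -> : (fun k => jacobian_col P (u s k)) = cst V.
      by apply/funext => k; rewrite (near_eq_jacobian_col (fP k) (df _)) Jf.
    exact: cvg_cst.
have inner y (k : nat) : soc y ->
    \forall z \near y + k.+1%:R^-1 *: soc_axis R n, soc z.
  rewrite socE => Ky; apply: near_soc.
  rewrite soc_tailD soc_tailZ soc_tail_axis scaler0 addr0 !mxE !eqxx mulr1.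
  by rewrite (le_lt_trans Ky) // ltrDl invr_gt0.
have [xK|xK|xK] := soc_cases x.
- exists 1%:M; apply: (interior id 1) => [y|y|k]; first exact: ex_diff.
    exact: jacobian_col_id.
  rewrite /u scale1r; have := inner x k xK.
  by apply: filterS => y Ky; rewrite /P (moreau_metric_proj (moreau_soc Ky)).
- exists 0; apply: (interior (cst 0) (-1)) => [y|y|k]; first exact: ex_diff.
    exact: jacobian_col_cst.
  have := inner (- x) k xK; set v := _ + _ => vK.
  (* Reflection through the origin reduces this case to interior points near [- x]. *)
  have -> : u (-1) k = - v.
    by rewrite /u /v opprD opprK scaleN1r scalerN.
  have vKN : \forall y \near - v, soc (- y).
    have /= := @opp_continuous 'cV[R]_n.+1 (- v).
    by rewrite /continuous_at opprK => oc; exact: (oc _ vK).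
  move: vKN; apply: filterS => y Ky.
  by rewrite /P (moreau_metric_proj (moreau_socN Ky)).
(* The constant sequence at [x] serves here. *)
- exists (jacobian_col P x), (fun=> x); split=> [_||]; last 2 first.
  + exact: (@cvg_cst _ x).
  + exact: (@cvg_cst _ (jacobian_col P x)).
  + apply: (@near_eq_differentiable _ _ _ (@soc_midproj R n)).
      have := near_mid xK; apply: filterS => y yK.
      by rewrite /P (moreau_metric_proj (moreau_midproj yK)).
    by apply: differentiable_midproj; rewrite (le_lt_trans _ xK).
Qed.

(** * Nonsingularity of the Newton matrix *)

(** [kermx] is the left kernel, hence the passage to the transpose. *)
Lemma unitmx_inj (F : fieldType) (n : nat) (A : 'M[F]_n) :
  (forall h : 'cV[F]_n, A *m h = 0 -> h = 0) -> A \in unitmx.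
Proof.
move=> A_inj; rewrite -unitmx_tr -row_free_unit -kermx_eq0.
apply/rowV0P => v /sub_kermxP vA; apply: trmx_inj; rewrite trmx0.
by apply: A_inj; rewrite -[A]trmxK -trmx_mul vA trmx0.
Qed.

Lemma newton_mx_unit (R : realType) (n : nat) (M V : 'M[R]_n.+1)
    (x : 'cV[R]_n.+1) :
  posdef M -> Bsubdiff (metric_proj (@soc R n)) x V ->
  newton_mx M V \in unitmx.
Proof.
move=> Mpos BV; apply: unitmx_inj => h.
rewrite /newton_mx mulmxDl mul1mx -mulmxA mulmxBl mul1mx => eq0.
have MVh : M *m (V *m h) = V *m h - h.
  by apply/eqP; rewrite -subr_eq0 opprB addrA addrAC eq0.
have Vh0 : V *m h = 0.
  apply/eqP/negPn/negP => /Mpos; rewrite MVh dotDl dotNl (dotC h).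
  by have := Bsubdiff_proj_firm h BV; lra.
by move: eq0; rewrite Vh0 mulmx0 subrr add0r.
Qed.

(** * Cocoercivity and the rate of one Newton step *)

Lemma dot_mulmx (R : realType) (n : nat) (A : 'M[R]_n) (x y : 'cV[R]_n) :
  dot (A *m x) y = dot (A^T *m y) x.
Proof.
have dotE (u v : 'cV[R]_n) : dot u v = (u^T *m v) 0 0.
  by rewrite mxE; apply: eq_bigr => i _; rewrite mxE.
by rewrite dotC !dotE trmx_mul trmxK mulmxA.
Qed.

Lemma posdef_ge0 (R : realType) (n : nat) (A : 'M[R]_n) (x : 'cV[R]_n) :
  posdef A -> 0 <= dot (A *m x) x.
Proof.
move=> Apos; have [->|/Apos/ltW//] := eqVneq x 0.
by rewrite dotC dot0l.
Qed.

(** Cauchy-Schwarz for the form of [A] at [z] and [y = A z] gives [|y|^4 <= <A z, z> <A y, y> <= <A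
    z, z> |A| |y|^2]; then [|y|^2] cancels. *)
Lemma posdef_cocoercive (R : realType) (n : nat) (A : 'M[R]_n)
    (z : 'cV[R]_n) :
  A^T = A -> posdef A ->
  dot (A *m z) (A *m z) <= opnorm A * dot (A *m z) z.
Proof.
move=> Asym Apos; set y := A *m z.
have [->|yN0] := eqVneq y 0; first by rewrite !dot0l mulr0.
have ypos : 0 < dot y y.
  rewrite lt_neqAle dot_ge0 andbT eq_sym.
  by apply: contra_neq yN0; exact: dot_eq0.
have A_sym (u v : 'cV[R]_n) : dot (A *m u) v = dot (A *m v) u.
  by rewrite dot_mulmx Asym.
have := cauchy_schwarz_form z y A_sym (fun u => posdef_ge0 u Apos).
have Ay : dot (A *m y) y <= opnorm A * dot y y.
  rewrite (le_trans (dot_le_enorm _ _)) // -sqr_enorm expr2 mulrA.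
  by rewrite ler_wpM2r ?enorm_ge0 // enorm_mulmx_le.
rewrite -/y => /le_trans/(_ (ler_wpM2l (posdef_ge0 z Apos) Ay)).
by rewrite -/y expr2 mulrA (ler_pM2r ypos) mulrC.
Qed.

Lemma opnorm_ge0 (R : realType) (n : nat) (E : 'M[R]_n.+1) : 0 <= opnorm E.
Proof.
have axis1 : enorm (soc_axis R n) = 1.
  by rewrite /enorm dot_coordE soc_axis0 sqrtr1.
have := enorm_mulmx_le E (soc_axis R n); rewrite axis1 mulr1.
exact/le_trans/enorm_ge0.
Qed.

(* [2 a - d] and [2 b - d] have norm at most that of [d], and [a - b] is half
   their difference. *)
Lemma firm_sub_le (R : realType) (n : nat) (a b d : 'cV[R]_n) :
  dot a a <= dot a d -> dot b b <= dot b d -> enorm (a - b) <= enorm d.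
Proof.
move=> ad bd; rewrite enorm_le; have := dot_ge0 (a + b - d).
by rewrite !dotlin (dotC d a) (dotC d b) (dotC b a); lra.
Qed.

Lemma newton_step_rate (R : realType) (n : nat) (M : 'M[R]_n.+1)
    (q xs x y : 'cV[R]_n.+1) :
  M^T = M -> posdef (M - 1%:M) -> newton_equation M q xs ->
  newton_step M q x y ->
  enorm (xs - y) <= opnorm (M - 1%:M) * enorm (xs - x).
Proof.
move=> Msym; rewrite /newton_equation.
set P := metric_proj _; set A := M - 1%:M => Apos xsE [V BV].
have Asym : A^T = A by rewrite /A linearB /= trmx1 Msym.
rewrite /newton_mx -/A mulmxDl mul1mx -mulmxA => yE.
set e := xs - y; set w := V *m xs - P xs.
(* The equations for [xs] and [y] have the same right side [- q] and are subtracted. *)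
have eE : e = A *m (w - V *m e).
  have zmod (a b c s t : 'cV[R]_n.+1) :
      s - t - (a - b - (a - c)) = b + s - (c + t).
    by apply/colP => i; rewrite !mxE; ring.
  by apply/subr0_eq; rewrite /w /e !mulmxBr zmod xsE yE subrr.
have w_le : enorm w <= enorm (xs - x).
  (* The identity [V x = P x] brings in the iterate, and [w] becomes a difference of two vectors
     that are both firm with respect to [xs - x]. *)
  have -> : w = V *m (xs - x) - (P xs - P x).
    by rewrite mulmxBr (Bsubdiff_proj_self BV) opprB addrA subrK.
  by apply: firm_sub_le; [exact: Bsubdiff_proj_firm BV|exact: metric_proj_firm].
apply: le_trans (ler_wpM2l (opnorm_ge0 A) w_le).
have [e0|eN0] := eqVneq (enorm e) 0.
  by rewrite e0 mulr_ge0 ?opnorm_ge0 ?enorm_ge0.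
have epos : 0 < enorm e by rewrite lt_neqAle eq_sym eN0 enorm_ge0.
(* After multiplication by [|e|] the left side is [<A z, A z>] with [z = w - V e], as cocoercivity
   requires. *)
rewrite -(ler_pM2r epos) -expr2 sqr_enorm {1 2}eE.
apply: le_trans (posdef_cocoercive _ Asym Apos) _.
rewrite -eE -mulrA ler_wpM2l ?opnorm_ge0 // dotDr dotNr.
rewrite [enorm w * _]mulrC; apply: le_trans (dot_le_enorm e w).
(* Since [<V e, e> >= |V e|^2 >= 0], dropping [- V e] can only increase the product with [e]. *)
have := Bsubdiff_proj_firm e BV; have := dot_ge0 (V *m e).
by rewrite (dotC e (V *m e)); lra.
Qed.

(** * Unique solvability of the equation and the complementarity problem *)

(* Banach's theorem is applied to an iterate: a Euclidean contraction need not
   contract the library's sup norm, but a high enough power of it does. *)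
Lemma enorm_contraction_fixpoint (R : realType) (n : nat)
    (f : 'cV[R]_n -> 'cV[R]_n) (c : R) :
  0 <= c -> c < 1 ->
  (forall x y, enorm (f x - f y) <= c * enorm (x - y)) ->
  exists p, f p = p.
Proof.
move=> c0 c1 fc.
have iter_le m x y : enorm (iter m f x - iter m f y) <= c ^+ m * enorm (x - y).
  elim: m => [|m ih] /=; first by rewrite expr0 mul1r.
  by rewrite (le_trans (fc _ _)) // exprS -mulrA ler_wpM2l.
(* The factor [Num.sqrt n%:R] is the price of passing from the Euclidean norm back to the sup
   norm. *)
have [m qm1] : exists m, c ^+ m * Num.sqrt n%:R < 1.
  have c1' : `|c| < 1 by rewrite ger0_norm.
  have /cvgrPdist_lt/(_ 1 ltr01)[m _ /(_ m (leqnn m))] :=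
    @cvg_geometric R (Num.sqrt n%:R) c c1'.
  rewrite sub0r normrN ger0_norm ?mulr_ge0 ?exprn_ge0 //= mulrC => m1.
  by exists m.
set k := c ^+ m * _ in qm1; have k0 : 0 <= k by rewrite mulr_ge0 ?exprn_ge0.
have iter_norm x y : `|iter m f x - iter m f y| <= k * `|x - y|.
  rewrite (le_trans (normr_le_enorm _)) // (le_trans (iter_le _ _ _)) //.
  by rewrite /k -mulrA ler_wpM2l ?exprn_ge0 // enorm_le_normr.
pose X : completeNormedModType R := HB.pack 'cV[R]_n.
have ctr : is_contraction (totalfun (iter m f : X -> X)).
  by exists (NngNum k0); split=> // -[x y] _ /=; exact: iter_norm.
have [p _ pE] := banach_fixed_point ctr closedT (ex_intro _ (0 : X) I).
(* The fixed point [p] of the iterate is fixed by [f]: [f p] is also a fixed point of the iterate,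
   so [|f p - p| <= k |f p - p|] with [k < 1]. *)
exists p; apply/subr0_eq/normr0_eq0/le_anti; rewrite normr_ge0 andbT.
have := iter_norm (f p) p; rewrite -iterSr iterS -[iter m f p]pE.
have := normr_ge0 (f p - p); nra.
Qed.

(** Subtracting the equations gives [y - x = A (P x - P y)], and [P] is nonexpansive while
    [|A| < 1]. *)
Lemma newton_equation_unique (R : realType) (n : nat) (M : 'M[R]_n.+1)
    (q x y : 'cV[R]_n.+1) :
  opnorm (M - 1%:M) < 1 -> newton_equation M q x -> newton_equation M q y ->
  y = x.
Proof.
rewrite /newton_equation; set A := _ - _; set P := metric_proj _ => A1 xE yE.
have xy : y - x = A *m (P x - P y).
  have zmod (a b s t : 'cV[R]_n.+1) : s - t - (a - b) = b + s - (a + t).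
    by apply/colP => i; rewrite !mxE; ring.
  by apply/subr0_eq; rewrite mulmxBr zmod xE yE subrr.
apply/subr0_eq/enorm_eq0/le_anti; rewrite enorm_ge0 andbT.
have : enorm (y - x) <= opnorm A * enorm (y - x).
  rewrite {1}xy (le_trans (enorm_mulmx_le _ _)) // ler_wpM2l ?opnorm_ge0 //.
  by rewrite -(enormN (y - x)) opprB metric_proj_nonexpansive.
have := enorm_ge0 (y - x); nra.
Qed.

(** Solutions are the fixed points of [x |-> - q - A (P x)], a Euclidean contraction with constant
    [|A|]. *)
Lemma newton_equation_solvable (R : realType) (n : nat) (M : 'M[R]_n.+1)
    (q : 'cV[R]_n.+1) :
  opnorm (M - 1%:M) < 1 -> exists x, newton_equation M q x.
Proof.
rewrite /newton_equation; set A := _ - _; set P := metric_proj _ => A1.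
have [|p pE] := @enorm_contraction_fixpoint R _
    (fun x => - q - A *m P x) _ (opnorm_ge0 A) A1.
  move=> x y; have -> : - q - A *m P x - (- q - A *m P y) = A *m (P y - P x).
    by rewrite mulmxBr opprB opprK addrC addrA addrK.
  rewrite (le_trans (enorm_mulmx_le _ _)) // ler_wpM2l ?opnorm_ge0 //.
  by rewrite -(enormN (x - y)) opprB metric_proj_nonexpansive.
by exists p; rewrite -[X in _ + X]pE addrC subrK.
Qed.

(** The equation rearranges to [M p + q = p - x] with [p = P x], so the complementarity conditions
    are exactly the Moreau conditions. *)
Lemma newton_equation_lcp (R : realType) (n : nat) (M : 'M[R]_n.+1)
    (q x : 'cV[R]_n.+1) :
  newton_equation M q x -> soc_lcp_solution M q (metric_proj (@soc R n) x).
Proof.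
rewrite /newton_equation mulmxBl mul1mx => xE.
have [Kp Kpx px0] := metric_proj_moreau x; set p := metric_proj _ x in xE *.
have Mpq : M *m p + q = p - x by rewrite -[q]opprK -xE opprD opprB addrA subrKC.
by split; rewrite ?Mpq.
Qed.

(** * Linear convergence of the Newton sequence *)

Lemma cvg_linear_rate (R : realType) (n : nat) (c : R) (xs : 'cV[R]_n)
    (x : nat -> 'cV[R]_n) :
  0 <= c -> c < 1 ->
  (forall k, enorm (xs - x k.+1) <= c * enorm (xs - x k)) ->
  x @ \oo --> xs.
Proof.
move=> c0 c1 rate; apply/cvg_enorm_dist.
have geo k : enorm (xs - x k) <= enorm (xs - x 0%N) * c ^+ k.
  elim: k => [|k ih]; first by rewrite expr0 mulr1.
  by rewrite (le_trans (rate k)) // exprS mulrCA ler_wpM2l.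
have c1' : `|c| < 1 by rewrite ger0_norm.
apply: squeeze_cvgr (cvg_cst 0) (@cvg_geometric R (enorm (xs - x 0%N)) c c1').
by apply: nearW => k; rewrite enorm_ge0 geo.
Qed.

Theorem theorem5 (R : realType) (n : nat) (M : 'M[R]_n.+1) (q : 'cV[R]_n.+1)
    (M_sym : M \is symmetricmx) (M_pos : posdef M) :
  (forall x0 : 'cV[R]_n.+1, newton_well_defined M q x0) /\
  (posdef (M - 1%:M) -> opnorm (M - 1%:M) < 1 ->
   exists xs : 'cV[R]_n.+1,
     [/\ newton_equation M q xs,
         forall y : 'cV[R]_n.+1, newton_equation M q y -> y = xs,
         forall (x0 : 'cV[R]_n.+1) (x : nat -> 'cV[R]_n.+1),
           newton_sequence M q x0 x ->
           x @ \oo --> xs /\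
           forall k : nat,
             enorm (xs - x k.+1) <= opnorm (M - 1%:M) * enorm (xs - x k)
       & soc_lcp_solution M q (metric_proj (@soc R n) xs)]).
Proof.
have Msym : M^T = M.
  (* [symmetricmx] is the Hermitian predicate with sign exponent 0 and the identity as
     involution. *)
  by move/is_hermitianmxP : M_sym; rewrite expr0 scale1r map_mx_id // => {2}->.
split=> [x0 k x _ _|Apos A1].
  split=> [|V BV]; first exact: Bsubdiff_proj_nonempty.
  have unitV := newton_mx_unit M_pos BV; split=> //.
  exists (invmx (newton_mx M V) *m - q); split=> [|y <-].
    by rewrite mulKVmx.
  by rewrite mulKmx.
have [xs xsE] := newton_equation_solvable q A1; exists xs; split=> //.
- by move=> y; exact: newton_equation_unique.
- move=> x0 x [_ step].
  have rate k := newton_step_rate Msym Apos xsE (step k).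
  by split=> //; exact: cvg_linear_rate (opnorm_ge0 _) A1 rate.
- exact: newton_equation_lcp.
Qed.
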